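(* For every $K>0$ there exists a constant $C=C(K)>0$, depending only on $K$, such that the following holds. Let $\mathcal{X}\subset\mathbb{R}^n$ be a set of $N$ points and let $\varepsilon\in(0,1)$. Let $A$ be an $m\times n$ random matrix whose rows $X_1,\dots,X_m$ are independent, mean zero, isotropic and sub-gaussian random vectors in $\mathbb{R}^n$ with $\|X_i\|_{\psi_2}\le K$ for all $i$, and set $P:=\frac{1}{\sqrt m}A$. If $$m\ge C\varepsilon^{-2}\log N,$$ then with probability at least $0.99$, $$(1-\varepsilon)\|x-y\|_2\le\|Px-Py\|_2\le(1+\varepsilon)\|x-y\|_2\quad\text{for all }x,y\in\mathcal{X}.$$
   Context: $\|\cdot\|_2$ is the Euclidean norm. A random vector $X$ in $\mathbb{R}^n$ is isotropic if $\mathbb{E}XX^{\mathsf T}=I_n$. For a real random variable $Z$, the sub-gaussian norm is $\|Z\|_{\psi_2}:=\inf\{t>0:\ \mathbb{E}\exp(Z^2/t^2)\le 2\}$, and $Z$ is sub-gaussian if this is finite. A random vector $X$ in $\mathbb{R}^n$ is sub-gaussian if $\langle X,x\rangle$ is sub-gaussian for every $x\in\mathbb{R}^n$, and $\|X\|_{\psi_2}:=\sup_{x\in S^{n-1}}\|\langle X,x\rangle\|_{\psi_2}$, where $S^{n-1}$ is the unit Euclidean sphere. *)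

(* Defs.v *)
From mathcomp Require Import all_boot all_order all_algebra.
From mathcomp Require Import all_classical all_reals all_analysis.
Import Order.TTheory GRing.Theory Num.Theory.
Import numFieldNormedType.Exports.

Set Implicit Arguments.
Unset Strict Implicit.
Unset Printing Implicit Defensive.

Local Open Scope classical_set_scope.
Local Open Scope ring_scope.

(* Vectors of R^n are columns.  The norm `|_| of the library on matrices is the
   max norm, hence the separate Euclidean norm. *)
Definition dotv (R : realType) (n : nat) (u v : 'cV[R]_n) : R :=
  \sum_(i < n) u i 0 * v i 0.

Definition norm2 (R : realType) (n : nat) (u : 'cV[R]_n) : R :=
  Num.sqrt (\sum_(i < n) u i 0 ^+ 2).

Definition sphere2 (R : realType) (n : nat) : set 'cV[R]_n :=
  [set u | norm2 u = 1].

(* The space of p x q matrices with its Borel sigma-algebra. *)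
Definition borel_mx (R : realType) (p q : nat) :=
  g_sigma_algebraType (@open 'M[R]_(p, q)).

Definition random_mx (d : measure_display) (T : measurableType d)
    (R : realType) (p q : nat) (M : T -> 'M[R]_(p, q)) : Prop :=
  measurable_fun [set: T] (M : T -> borel_mx R p q).

Definition row_vec (T : Type) (R : realType) (m n : nat)
    (A : T -> 'M[R]_(m, n)) (i : 'I_m) : T -> 'cV[R]_n :=
  fun w => (row i (A w))^T.

(* Mutual independence: the product rule for every subfamily J. *)
Definition independent_vecs (d : measure_display) (T : measurableType d)
    (R : realType) (P : probability T R) (m n : nat)
    (X : 'I_m -> T -> 'cV[R]_n) : Prop :=
  forall (J : {set 'I_m}) (B : 'I_m -> set (borel_mx R n 1)),
    (forall i, i \in J -> measurable (B i)) ->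
    P (\bigcap_(i in [set` J]) X i @^-1` B i) =
      (\prod_(i in J) P (X i @^-1` B i))%E.

(* Entrywise expectation.  An extended-real integral with a finite value forces
   integrability, so equating this to a real matrix includes integrability of
   every entry. *)
Definition expectation_mx (d : measure_display) (T : measurableType d)
    (R : realType) (P : probability T R) (p q : nat)
    (M : T -> 'M[R]_(p, q)) : 'M[\bar R]_(p, q) :=
  \matrix_(i, j) ('E_P[fun w => M w i j])%E.

Definition mean_zero (d : measure_display) (T : measurableType d)
    (R : realType) (P : probability T R) (n : nat)
    (X : T -> 'cV[R]_n) : Prop :=
  expectation_mx P X = map_mx EFin 0.

Definition isotropic (d : measure_display) (T : measurableType d)
    (R : realType) (P : probability T R) (n : nat)
    (X : T -> 'cV[R]_n) : Prop :=
  expectation_mx P (fun w => X w *m (X w)^T) = map_mx EFin 1%:M.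

(* Equals +oo when no admissible t exists. *)
Definition psi2_norm (d : measure_display) (T : measurableType d)
    (R : realType) (P : probability T R) (Z : T -> R) : \bar R :=
  ereal_inf [set t%:E | t in [set t : R | 0 < t /\
    ('E_P[fun w => expR (Z w ^+ 2 / t ^+ 2)] <= 2%:E)%E]].

Definition subgaussian (d : measure_display) (T : measurableType d)
    (R : realType) (P : probability T R) (Z : T -> R) : Prop :=
  (psi2_norm P Z < +oo)%E.

Definition subgaussian_vec (d : measure_display) (T : measurableType d)
    (R : realType) (P : probability T R) (n : nat)
    (X : T -> 'cV[R]_n) : Prop :=
  forall x : 'cV[R]_n, subgaussian P (fun w => dotv (X w) x).

Definition psi2_norm_vec (d : measure_display) (T : measurableType d)
    (R : realType) (P : probability T R) (n : nat)
    (X : T -> 'cV[R]_n) : \bar R :=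
  ereal_sup [set psi2_norm P (fun w => dotv (X w) x) | x in @sphere2 R n].

(* Main.v *)
Require Import Defs.
From mathcomp Require Import all_boot all_order all_algebra.
From mathcomp Require Import all_classical all_reals all_analysis.
From mathcomp Require Import measurable_realfun.
From mathcomp Require Import ring lra.
Import Order.TTheory GRing.Theory Num.Theory.
Import numFieldNormedType.Exports.

(* For a unit vector u, W_i = <X_i, u>^2 has mean 1 by isotropy, and
   E exp(W_i / L) <= 2 with L = 4 K^2 + 1.  The inequality
   e^y <= 1 + y + y^2 e^|y| then gives E exp(l (W_i - 1)) <= exp(32 L^2 l^2)
   for |l| <= 1/(2L).  Independence and Markov's inequality with
   l = +- eps / (64 L^2) bound each tail of |A u|^2 / m - 1 at eps by
   exp(- eps^2 m / (128 L^2)), which is at most N^-10 when C = 1280 L^2, and a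
   union bound over the N^2 pairs of points costs only a factor N^2. *)

Local Open Scope classical_set_scope.
Local Open Scope ring_scope.

(** * Elementary bounds on the exponential *)

Lemma expR_le_quadratic (R : realType) (y : R) :
  expR y <= 1 + y + y ^+ 2 * expR `|y|.
Proof.
(* This is [1 - x <= exp(-x)] multiplied by [exp x]. For [y >= 0] it is applied twice. For [y < 0],
   multiplying [1 + y <= exp y] by [y] gives [y * exp y <= y + y^2]. *)
have h (x : R) : expR x <= 1 + x * expR x.
  have := expR_ge1Dx (- x); rewrite -(ler_pM2r (expR_gt0 x)) mulrDl mul1r mulNr.
  by rewrite -expRD addNr expR0; lra.
have [y0|y0] := leP 0 y.
  rewrite ger0_norm// (le_trans (h y))//.
  have := ler_wpM2l y0 (h y); lra.
have e1 : 1 <= expR `|y| by rewrite -expR0 ler_expR.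
have /= e2 : y ^+ 2 <= y ^+ 2 * expR `|y| by rewrite ler_peMr// sqr_ge0.
have := expR_ge1Dx y; rewrite -(ler_nM2l y0) => e3.
have := h y; lra.
Qed.

Lemma sqr_le_expR (R : realType) (x : R) : 0 <= x -> x ^+ 2 <= 4 * expR x.
Proof.
move=> x0; have := expR_ge1Dxn 1 x0; have := expR_gt0 x.
by rewrite (_ : (2`!%:R : R) = 2)//; lra.
Qed.

(** * Expectation of a product of independent nonnegative variables *)

Section expectation_prod.
Context d (T : measurableType d) (R : realType) (P : probability T R).

(** By Tonelli, [E[G f]] is the integral over [t >= 0] of [E[G; f > t]]; the hypothesis factors the
    integrand for each [t], and the remaining integral of [P(f > t)] is [E f]. *)
Lemma integralM_indep (G f : T -> R) :
  measurable_fun [set: T] G -> measurable_fun [set: T] f ->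
  (forall w, 0 <= G w) -> (forall w, 0 <= f w) ->
  (forall t : R, (\int[P]_w (G w * \1_(f @^-1` `]t, +oo[) w)%:E =
     (\int[P]_w (G w)%:E) * P (f @^-1` `]t, +oo[))%E) ->
  (\int[P]_w (G w * f w)%:E =
     (\int[P]_w (G w)%:E) * (\int[P]_w (f w)%:E))%E.
Proof.
move=> mG mf G0 f0 indep.
pose mu : {measure set (measurableTypeR R) -> \bar R} := @lebesgue_measure R.
pose D : set R := `[0, +oo[%classic.
have mD : measurable (D : set (measurableTypeR R)) by exact: measurable_itv.
(* The subgraph of [f]: its measurability yields that of the integrand on the product space, and
   that of [t |-> P(f > t)] as the measure of a section. *)
have mlt : measurable [set p : T * measurableTypeR R | (p.2 < f p.1)%R].
  have : measurable_fun setT (fun p : T * measurableTypeR R => p.2 < f p.1)%R.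
    apply: measurable_fun_ltr; first exact: measurable_snd.
    by apply: measurableT_comp => //; exact: measurable_fst.
  by move=> /(_ measurableT [set true]); rewrite setTI; exact.
(* Layer cake: f w is the integral over t >= 0 of the indicator of t < f w. *)
have layer (H : T -> R) : measurable_fun [set: T] H -> (forall w, 0 <= H w) ->
    (\int[P]_w (H w * f w)%:E =
      \int[mu]_t ((\1_D t)%:E * \int[P]_w (H w * \1_(f @^-1` `]t, +oo[) w)%:E))%E.
  move=> mH H0.
  transitivity (\int[P]_w \int[mu]_t
     (\1_D t * (H w * \1_(f @^-1` `]t, +oo[) w))%:E)%E.
    apply: eq_integral => w _.
    transitivity ((H w)%:E * \int[mu]_t (\1_(`[0, f w[%classic) t)%:E)%E.
      rewrite integral_indic//=.
      rewrite setIT lebesgue_measure_itv/= lte_fin -EFinB subr0.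
      case: ifPn => // /negPf; rewrite lt_neqAle f0 andbT => /negbFE/eqP <-.
      by rewrite mulr0 mule0.
    rewrite -ge0_integralZl//.
    - apply: eq_integral => t _; rewrite -EFinM; congr (_%:E).
      rewrite mulrCA; congr *%R; rewrite !indicE -natrM mulnb; congr (_%:R).
      congr nat_of_bool; rewrite /D; apply/idP/andP.
        by rewrite !inE/= !in_itv/= !andbT => /andP[].
      by rewrite !inE/= !in_itv/= !andbT => -[-> ->].
    - exact/measurable_EFinP/measurable_indic.
    - by rewrite lee_fin.
  pose F (p : T * measurableTypeR R) : \bar R :=
    (\1_D p.2 * (H p.1 * \1_[set p | (p.2 < f p.1)%R] p))%:E.
  have FE w t : (\1_D t * (H w * \1_(f @^-1` `]t, +oo[) w))%:E = F (w, t).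
    rewrite /F/=; congr (_ * (_ * _))%:E; rewrite !indicE; congr (nat_of_bool _)%:R.
    by apply/idP/idP; rewrite !inE/= in_itv/= andbT.
  have F0 p : (0 <= F p)%E by rewrite lee_fin !mulr_ge0// indicE.
  have mF : measurable_fun setT F.
    apply/measurable_EFinP; apply: measurable_funM.
      apply: (@measurableT_comp _ _ _ _ _ _ (\1_D : measurableTypeR R -> R)).
        exact: measurable_indic.
      exact: measurable_snd.
    apply: measurable_funM; last exact: measurable_indic.
    by apply: measurableT_comp => //; exact: measurable_fst.
  transitivity (\int[P]_w \int[mu]_t F (w, t))%E.
    by apply: eq_integral => w _; apply: eq_integral => t _; exact: FE.
  rewrite (fubini_tonelli F)//; apply: eq_integral => t _.
  rewrite -ge0_integralZl//.
  - by apply: eq_integral => w _; rewrite -FE.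
  - apply/measurable_EFinP; apply: measurable_funM => //.
    apply: measurable_indic; rewrite -[X in measurable X]setTI.
    exact: mf.
  - by move=> w _; rewrite lee_fin mulr_ge0// indicE.
have intG0 : (0 <= \int[P]_w (G w)%:E)%E.
  by apply: integral_ge0 => w _; rewrite lee_fin.
have layer1 := layer (cst 1) (@measurable_cst _ _ _ _ _ _) (fun=> ler01).
have -> : (\int[P]_w (f w)%:E =
    \int[mu]_t ((\1_D t)%:E * P (f @^-1` `]t, +oo[)))%E.
  transitivity (\int[P]_w (cst 1 w * f w)%:E)%E.
    by apply: eq_integral => w _; rewrite mul1r.
  rewrite layer1; apply: eq_integral => t _; congr (_ * _)%E.
  transitivity (\int[P]_w (\1_(f @^-1` `]t, +oo[) w)%:E)%E.
    by apply: eq_integral => w _; rewrite mul1r.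
  rewrite integral_indic ?setIT//.
  by rewrite -[X in measurable X]setTI; exact: mf.
rewrite layer// -ge0_integralZl//.
- by apply: eq_integral => t _; rewrite indep muleCA.
- apply: emeasurable_funM; first exact/measurable_EFinP/measurable_indic.
  rewrite [X in measurable_fun _ X](_ : _ =
      P \o ysection [set p : T * measurableTypeR R | (p.2 < f p.1)%R]).
    exact: measurable_fun_ysection.
  apply/funext => t /=; congr (P _); apply/seteqP.
  by split => w; rewrite /ysection/= in_itv/= andbT inE.
- by move=> t _; rewrite mule_ge0// lee_fin indicE.
Qed.

(** Independence is given only for events. [integralM_indep] converts one factor at a time, because
    its hypothesis is again a product rule, with one more indicator. *)
Lemma expectation_prod_indep (I : finType) (Y : I -> T -> R) :
  (forall i, measurable_fun [set: T] (Y i)) ->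
  (forall i w, 0 <= Y i w) ->
  (forall (J : {set I}) (B : I -> set (measurableTypeR R)),
    (forall i, measurable (B i)) ->
    P (\bigcap_(i in [set` J]) Y i @^-1` B i) =
      (\prod_(i in J) P (Y i @^-1` B i))%E) ->
  (\int[P]_w (\prod_(i : I) Y i w)%:E = \prod_(i : I) \int[P]_w (Y i w)%:E)%E.
Proof.
move=> mY Y0 indep.
have mYB i (B : set (measurableTypeR R)) : measurable B -> measurable (Y i @^-1` B).
  by move=> mB; rewrite -[X in measurable X]setTI; exact: mY.
(* Indicators are replaced by the functions themselves one index at a time:
   [s] lists the indices already treated. *)
suff H (s : seq I) (J : {set I}) (B : I -> set (measurableTypeR R)) :
    uniq s -> (forall i, i \in s -> i \notin J) -> (forall i, measurable (B i)) ->
    (\int[P]_w ((\prod_(i <- s) Y i w) * \prod_(i in J) \1_(Y i @^-1` B i) w)%:E =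
     (\prod_(i <- s) \int[P]_w (Y i w)%:E) * \prod_(i in J) P (Y i @^-1` B i))%E.
  have := H (index_enum I) finset.set0 (fun=> setT) (index_enum_uniq I).
  rewrite big_set0 mule1 => <- //.
  - by apply: eq_integral => w _; rewrite big_set0 mulr1.
  - by move=> i _; rewrite inE.
elim: s J B => [J B _ _ mB|i s IH J B /= /andP[si us] sJ mB].
  rewrite big_nil mul1e -indep// -[in RHS](setIT (\bigcap_(i in _) _)) -integral_indic//.
    apply: eq_integral => w _; rewrite big_nil mul1r; congr (_%:E).
    rewrite indicE; have [wJ|/existsNP[j /not_implyP[jJ wj]]] :=
      pselect ((\bigcap_(i in [set` J]) Y i @^-1` B i) w).
      rewrite mem_set// big1// => j jJ; rewrite indicE mem_set//; exact: wJ.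
    rewrite memNset; last by move=> /(_ j jJ).
    by rewrite (bigD1 j)//= indicE memNset// mul0r.
  apply: fin_bigcap_measurable => // j _; exact: mYB.
pose G w := (\prod_(i <- s) Y i w) * \prod_(i in J) \1_(Y i @^-1` B i) w.
have iJ : i \notin J by apply: sJ; rewrite inE eqxx.
have sJ' j : j \in s -> j \notin J by move=> js; apply: sJ; rewrite inE js orbT.
have EG := IH J B us sJ' mB.
transitivity (\int[P]_w (G w * Y i w)%:E)%E.
  by apply: eq_integral => w _; rewrite big_cons /G; congr (_%:E); ring.
rewrite integralM_indep//.
- by rewrite EG big_cons muleAC; congr (_ * _)%E; rewrite muleC.
- rewrite /G; under eq_fun do rewrite -[X in _ * X]big_enum/=.
  apply: measurable_funM.
    exact: measurable_prod.
  apply: measurable_prod => j _; apply: measurable_indic; exact: mYB.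
- by move=> w; rewrite mulr_ge0// prodr_ge0// => j _; rewrite indicE.
move=> t.
(* The event [Y i > t] is absorbed into the family of indicators by adding [i] to [J], so the
   induction hypothesis for [s] also covers the product with this indicator. *)
pose B' j := if j == i then `]t, +oo[%classic else B j.
have B'J j : j \in J -> B' j = B j.
  by rewrite /B'; case: eqP => // -> ; rewrite (negPf iJ).
have sJi j : j \in s -> j \notin (i |: J)%SET.
  move=> js; rewrite finset.in_setU1 negb_or sJ'// andbT.
  by apply/eqP => ji; move: si; rewrite -ji js.
have mB' j : measurable (B' j : set (measurableTypeR R)).
  by rewrite /B'; case: ifP => _ ; [exact: measurable_itv|exact: mB].
transitivity (\int[P]_w ((\prod_(j <- s) Y j w) *
   \prod_(j in (i |: J)%SET) \1_(Y j @^-1` B' j) w)%:E)%E.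
  apply: eq_integral => w _; rewrite finset.big_setU1//= /G {1}/B' eqxx.
  rewrite [X in _ * (_ * X)](eq_bigr (fun j => \1_(Y j @^-1` B j) w)).
    by congr (_%:E); ring.
  by move=> j jJ; rewrite B'J.
rewrite IH// EG finset.big_setU1//= {1}/B' eqxx muleA [in RHS]muleAC.
congr (_ * _)%E; by apply: eq_bigr => j jJ; rewrite B'J.
Qed.
End expectation_prod.

(** * Matrix entries, and the exponential moment of one centred variable *)

Lemma measurable_fun_coord (R : realType) (p q : nat) (i : 'I_p) (j : 'I_q) :
  measurable_fun [set: borel_mx R p q] (fun M : borel_mx R p q => (M : 'M[R]_(p, q)) i j).
Proof.
apply: (measurability _ (RGenOpens.measurableE R)).
move=> _ [_ [a [b ->] <-]]; rewrite setTI; apply: sub_sigma_algebra.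
have /continuousP := @coord_continuous R p q i j; apply.
exact: interval_open.
Qed.

(** The quadratic bound is applied to [l W], and the factor [exp(-l)] is kept aside: since
    [E W = 1], it cancels the linear term once [1 + z <= exp z] is used. *)
Lemma mgf_subexponential_le d (T : measurableType d) (R : realType) (P : probability T R)
    (W : T -> R) (L l : R) :
  measurable_fun [set: T] W -> (forall w, 0 <= W w) -> 0 < L ->
  `|l| <= (2 * L)^-1 ->
  (\int[P]_w (W w)%:E = 1)%E ->
  (\int[P]_w (expR (W w / L))%:E <= 2%:E)%E ->
  (\int[P]_w (expR (l * (W w - 1)))%:E <= (expR (32 * L ^+ 2 * l ^+ 2))%:E)%E.
Proof.
move=> mW W0 L0 lL EW Eexp.
have mE : measurable_fun [set: T] (fun w => expR (W w / L)).
  by apply: measurableT_comp => //; apply: measurable_funM.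
(* With [x = W / (2L)], the exponent [W / L = 2x] is split in two: one [exp x] pays for [exp |l W|],
   by the bound on [l], the other for [W^2 = 4 L^2 x^2 <= 16 L^2 exp x]. *)
have ptw w : expR (l * (W w - 1)) <=
    expR (- l) * (1 + l * W w + 16 * L ^+ 2 * l ^+ 2 * expR (W w / L)).
  have -> : l * (W w - 1) = - l + l * W w by ring.
  rewrite expRD ler_pM2l ?expR_gt0// (le_trans (expR_le_quadratic _ _))//.
  rewrite lerD2l exprMn.
  have x0 : 0 <= W w / (2 * L) by rewrite divr_ge0// mulr_ge0// ltW.
  have h1 : expR `|l * W w| <= expR (W w / (2 * L)).
    by rewrite ler_expR normrM (ger0_norm (W0 w)) mulrC ler_wpM2l.
  have h2 := sqr_le_expR _ _ x0.
  have -> : W w / L = W w / (2 * L) + W w / (2 * L) by field; lra.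
  have -> : W w ^+ 2 = 4 * L ^+ 2 * (W w / (2 * L)) ^+ 2 by field; lra.
  rewrite expRD; set e := expR (W w / _) in h1 h2 *; set x := W w / _ in h2 *.
  have -> : 16 * L ^+ 2 * l ^+ 2 * (e * e) = l ^+ 2 * (4 * L ^+ 2 * (4 * e)) * e.
    by ring.
  apply: ler_pM => //; first by do ! (rewrite mulr_ge0 ?sqr_ge0//).
  by rewrite ler_wpM2l ?sqr_ge0// ler_wpM2l// mulr_ge0// sqr_ge0.
have iW : P.-integrable [set: T] (EFin \o W).
  apply/integrableP; split; first exact/measurable_EFinP.
  under eq_integral => w _ do rewrite /= ger0_norm//.
  by rewrite EW ltry.
have iE : P.-integrable [set: T] (fun w => (expR (W w / L))%:E).
  apply/integrableP; split; first exact/measurable_EFinP.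
  under eq_integral => w _ do rewrite /= ger0_norm ?expR_ge0//.
  exact: le_lt_trans Eexp (ltry _).
have iL : P.-integrable [set: T] (fun w => 1%:E + l%:E * (W w)%:E)%E.
  apply: integrableD => //; last exact: integrableZl.
  exact: finite_measure_integrable_cst.
have iR : P.-integrable [set: T] (fun w =>
    (1%:E + l%:E * (W w)%:E) + (16 * L ^+ 2 * l ^+ 2)%:E * (expR (W w / L))%:E)%E.
  apply: integrableD => //; exact: integrableZl.
apply: (@le_trans _ _ (\int[P]_w ((expR (- l))%:E *
   ((1%:E + l%:E * (W w)%:E) + (16 * L ^+ 2 * l ^+ 2)%:E * (expR (W w / L))%:E)))%E).
  apply: ge0_le_integral => //.
  - apply/measurable_EFinP; apply: measurableT_comp => //.
    by apply: measurable_funM => //; exact: measurable_funB.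
  - by apply: emeasurable_funM => //; exact: (measurable_int _ iR).
  - by move=> w _; have := ptw w; rewrite -lee_fin.
rewrite integralZl// integralD//; last exact: integrableZl.
rewrite integralD//; last 2 first.
- exact: finite_measure_integrable_cst.
- exact: integrableZl.
have P1 : P [set: T] = 1%E by exact: probability_setT.
rewrite !integralZl// EW integral_cst// [X in (1 * X)%E]P1 !mul1e mule1.
apply: (@le_trans _ _ ((expR (- l))%:E *
   (1%:E + l%:E + (16 * L ^+ 2 * l ^+ 2)%:E * 2%:E))%E).
  rewrite lee_pmul2l// ?lte_fin ?expR_gt0//.
  by rewrite leeD2l// lee_wpmul2l// lee_fin mulr_ge0 ?sqr_ge0// mulr_ge0 ?sqr_ge0.
(* Here [1 + z <= exp z] is used with [z = l + 32 L^2 l^2]; the 32 is 16 times the bound 2 on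
   [E exp(W / L)]. *)
have H : expR (- l) * (1 + l + 16 * L ^+ 2 * l ^+ 2 * 2) <= expR (32 * L ^+ 2 * l ^+ 2).
  have -> : 32 * L ^+ 2 * l ^+ 2 = - l + (l + 32 * L ^+ 2 * l ^+ 2) by ring.
  rewrite expRD ler_pM2l ?expR_gt0// (le_trans _ (expR_ge1Dx _))//; lra.
by rewrite -lee_fin in H.
Qed.

(** * Measurable functions of the rows and their product rule *)

Lemma measurable_dotv (R : realType) (n : nat) (u : 'cV[R]_n) :
  measurable_fun [set: borel_mx R n 1] (fun v : borel_mx R n 1 => dotv v u).
Proof.
apply: measurable_sum => i; apply: measurable_funM => //.
exact: measurable_fun_coord.
Qed.

Lemma measurable_row_vec d (T : measurableType d) (R : realType) (m n : nat)
    (A : T -> 'M[R]_(m, n)) (i : 'I_m) :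
  random_mx A ->
  measurable_fun [set: T] (row_vec A i : T -> borel_mx R n 1).
Proof.
move=> mA; apply: (@measurability _ _ T (borel_mx R n 1) setT _ (@open 'M[R]_(n, 1))) => //.
move=> _ [U oU <-]; rewrite setTI.
have cf : continuous (fun M : 'M[R]_(m, n) => (row i M)^T).
  move=> M U' /nbhs_ballP[e e0 eU]; apply/nbhs_ballP; exists e => // N [e1 MN].
  by apply: eU; split => // j k; rewrite !mxE.
have /continuousP/(_ U oU) oV := cf.
rewrite (_ : _ @^-1` U = A @^-1` ((fun M => (row i M)^T) @^-1` U))//.
rewrite -[X in measurable X]setTI; apply: mA => //.
exact: sub_sigma_algebra.
Qed.

Lemma expectation_prod_rows d (T : measurableType d) (R : realType)
    (P : probability T R) (m n : nat) (A : T -> 'M[R]_(m, n))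
    (phi : borel_mx R n 1 -> R) :
  random_mx A -> independent_vecs P (row_vec A) ->
  measurable_fun [set: borel_mx R n 1] phi -> (forall v, 0 <= phi v) ->
  (\int[P]_w (\prod_(i < m) phi (row_vec A i w))%:E =
   \prod_(i < m) \int[P]_w (phi (row_vec A i w))%:E)%E.
Proof.
move=> mA indep mphi phi0.
apply: (expectation_prod_indep _ _ _ _ _ (fun i w => phi (row_vec A i w))) => //.
  by move=> i; apply: (measurableT_comp mphi); exact: measurable_row_vec.
move=> J B mB; apply: (indep J (fun i => phi @^-1` B i)) => i _.
rewrite -[X in measurable X]setTI; exact: (mphi measurableT _ (mB i)).
Qed.

Lemma lee_prod (R : realType) (I : finType) (f g : I -> \bar R) :
  (forall i, 0 <= f i <= g i)%E -> (\prod_(i : I) f i <= \prod_(i : I) g i)%E.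
Proof.
move=> fg; suff /andP[] : (0 <= \prod_i f i <= \prod_i g i)%E by [].
elim/big_ind2 : _ => [|x1 x2 y1 y2 /andP[x0 x12] /andP[y0 y12]|i _] //.
  by rewrite lexx lee_fin ler01.
by rewrite mule_ge0//= lee_pmul.
Qed.

Lemma measurable_superlevel d (T : measurableType d) (R : realType) (f : T -> R)
    (a : R) : measurable_fun [set: T] f -> measurable [set w | a <= f w].
Proof.
move=> mf; rewrite (_ : mkset _ = f @^-1` `[a, +oo[%classic).
  by rewrite -[X in measurable X]setTI; apply: mf => //; exact: measurable_itv.
by apply/seteqP; split => w /=; rewrite in_itv/= andbT.
Qed.

(** * Bernstein's inequality by exponential Markov *)

Section bernstein.
Context d (T : measurableType d) (R : realType) (P : probability T R).

(** The sign [s] is 1 or -1, so one argument covers the upper and the lower tail; the moment bound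
    depends on [(r s)^2 = r^2] only. *)
Lemma bernstein_tail (m : nat) (W : 'I_m -> T -> R) (L eps s : R) :
  (forall i, measurable_fun [set: T] (W i)) -> (forall i w, 0 <= W i w) ->
  (forall i, \int[P]_w (W i w)%:E = 1)%E ->
  (forall i, \int[P]_w (expR (W i w / L))%:E <= 2%:E)%E ->
  (forall l : R, \int[P]_w (\prod_(i < m) expR (l * (W i w - 1)))%:E =
     \prod_(i < m) \int[P]_w (expR (l * (W i w - 1)))%:E)%E ->
  1 <= L -> 0 < eps < 1 -> `|s| = 1 ->
  (P [set w | (m%:R * eps <= s * (\sum_(i < m) W i w - m%:R))%R] <=
    (expR (- (eps ^+ 2 * m%:R / (128 * L ^+ 2))))%:E)%E.
Proof.
move=> mW W0 EW Eexp indep L1 /andP[e0 e1] s1.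
have L0 : 0 < L by lra.
set A := [set w | _].
(* The minimiser over [r] of the final exponent [- r m eps + 32 L^2 r^2 m]. *)
pose r := eps / (64 * L ^+ 2).
have r0 : 0 < r by rewrite divr_gt0// mulr_gt0// exprn_gt0.
have mS : measurable_fun [set: T] (fun w => s * (\sum_(i < m) W i w - m%:R)).
  apply: measurable_funM => //; apply: measurable_funB => //.
  exact: measurable_sum.
have mA : measurable A by exact: measurable_superlevel.
have mexp i : measurable_fun [set: T] (fun w => expR (r * s * (W i w - 1))).
  apply: measurableT_comp => //; apply: measurable_funM => //.
  exact: measurable_funB.
(* The moment bound is available at [r s] because [eps < 1 <= L] gives [eps <= 32 L]. *)
have rsL : `|r * s| <= (2 * L)^-1.
  rewrite normrM s1 mulr1 gtr0_norm// /r ler_pdivrMr; last by rewrite mulr_gt0// exprn_gt0.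
  have -> : (2 * L)^-1 * (64 * L ^+ 2) = 32 * L by field; lra.
  lra.
have s2 : s ^+ 2 = 1 by rewrite -real_normK ?num_real// s1 expr1n.
have mgf : (\int[P]_w (\prod_(i < m) expR (r * s * (W i w - 1)))%:E <=
    (expR (32 * L ^+ 2 * r ^+ 2 * m%:R))%:E)%E.
  rewrite indep (_ : expR _ = \prod_(i < m) expR (32 * L ^+ 2 * (r * s) ^+ 2)).
    rewrite -prodEFin; apply: lee_prod => i.
    apply/andP; split; first by apply: integral_ge0 => w _; rewrite lee_fin expR_ge0.
    exact: mgf_subexponential_le.
  rewrite prodr_const card_ord -expRM_natl mulrC.
  by rewrite (_ : (r * s) ^+ 2 = r ^+ 2)// exprMn s2 mulr1.
(* Markov's inequality, from the pointwise bound of [exp(r m eps)] times the indicator of [A] by the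
   product of exponentials. *)
have : ((expR (r * (m%:R * eps)))%:E * P A <=
    (expR (32 * L ^+ 2 * r ^+ 2 * m%:R))%:E)%E.
  apply: le_trans mgf.
  rewrite -[A in P A]setIT -integral_indic//.
  rewrite -ge0_integralZl//; last exact/measurable_EFinP/measurable_indic.
  apply: ge0_le_integral => //.
  - by apply: emeasurable_funM => //; exact/measurable_EFinP/measurable_indic.
  - by apply/measurable_EFinP; exact: measurable_prod.
  move=> w _; rewrite -EFinM lee_fin.
  have -> : \prod_(i < m) expR (r * s * (W i w - 1)) =
      expR (r * (s * (\sum_(i < m) W i w - m%:R))).
    rewrite -expR_sum -mulr_sumr sumrB sumr_const card_ord mulrA //.
  have [wA|wA] := pselect (A w).
    by rewrite indicE mem_set// mulr1 ler_expR ler_pM2l.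
  by rewrite indicE memNset// mulr0 expR_ge0.
rewrite -lee_pdivlMl ?expR_gt0// => /le_trans; apply.
rewrite lee_fin -expRN -expRD ler_expR /r.
rewrite le_eqVlt; apply/orP; left; apply/eqP; field; lra.
Qed.
End bernstein.

(** * Second and exponential moments of a row in a unit direction *)

Lemma norm2_sqr (R : realType) (n : nat) (u : 'cV[R]_n) :
  norm2 u ^+ 2 = \sum_(i < n) u i 0 ^+ 2.
Proof. by rewrite /norm2 sqr_sqrtr// sumr_ge0// => i _; rewrite sqr_ge0. Qed.

Section row_moments.
Context d (T : measurableType d) (R : realType) (P : probability T R).

Lemma isotropic_second_moment (n : nat) (X : T -> 'cV[R]_n) (u : 'cV[R]_n) :
  measurable_fun [set: T] (X : T -> borel_mx R n 1) -> isotropic P X ->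
  norm2 u = 1 ->
  (\int[P]_w ((dotv (X w) u) ^+ 2)%:E = 1)%E.
Proof.
move=> mX isoX u1.
have mXi i : measurable_fun [set: T] (fun w => X w i 0).
  by apply: (measurableT_comp (measurable_fun_coord R n 1 i 0)).
have EX i j : (\int[P]_w (X w i 0 * X w j 0)%:E = ((i == j)%:R)%:E)%E.
  have /matrixP/(_ i j) := isoX; rewrite !mxE unlock => <-.
  by apply: eq_integral => w _; rewrite !mxE big_ord1 !mxE.
have isq i : P.-integrable [set: T] (fun w => (X w i 0 ^+ 2)%:E).
  apply/integrableP; split; first exact/measurable_EFinP/measurable_funX.
  under eq_integral => w _ do rewrite /= ger0_norm ?sqr_ge0// expr2.
  by rewrite EX ltry.
(* The diagonal of [E X X^T] makes the squares integrable; mixed products are dominated through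
   [|a b| <= a^2 + b^2]. This licenses expanding the square under the integral. *)
have iXX i j : P.-integrable [set: T] (fun w => (X w i 0 * X w j 0)%:E).
  apply: (@le_integrable _ _ _ _ _ measurableT _
    (fun w => (X w i 0 ^+ 2)%:E + (X w j 0 ^+ 2)%:E)%E) => //.
  - exact/measurable_EFinP/measurable_funM.
  - move=> w _; rewrite -EFinD !abse_EFin lee_fin ler_norml.
    have a0 := sqr_ge0 (X w i 0 + X w j 0); have b0 := sqr_ge0 (X w i 0 - X w j 0).
    have c0 := sqr_ge0 (X w i 0); have d0 := sqr_ge0 (X w j 0).
    rewrite ger0_norm ?addr_ge0//; apply/andP; split; nra.
  - exact: integrableD.
have -> : (\int[P]_w ((dotv (X w) u) ^+ 2)%:E =
    \int[P]_w \sum_(i < n) \sum_(j < n) (u i 0 * u j 0)%:E * (X w i 0 * X w j 0)%:E)%E.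
  apply: eq_integral => w _; rewrite /dotv expr2 big_distrlr/= -sumEFin.
  apply: eq_bigr => i _; rewrite -sumEFin; apply: eq_bigr => j _.
  by rewrite -EFinM; congr (_%:E); ring.
rewrite integral_sum//; last first.
  by move=> i; apply: integrable_sum => // j _; exact: integrableZl.
transitivity (\sum_(i < n) (u i 0 ^+ 2)%:E)%E.
  apply: eq_bigr => i _; rewrite integral_sum//; last by move=> j; exact: integrableZl.
  rewrite (bigD1 i)//= big1 ?adde0.
    by rewrite integralZl// EX eqxx mule1 expr2.
  by move=> j ji; rewrite integralZl// EX eq_sym (negPf ji) mule0.
by rewrite sumEFin -norm2_sqr u1 expr1n.
Qed.

Lemma psi2_norm_vec_exp_moment (n : nat) (X : T -> 'cV[R]_n) (u : 'cV[R]_n) (K : R) :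
  measurable_fun [set: T] (X : T -> borel_mx R n 1) ->
  0 < K -> (psi2_norm_vec P X <= K%:E)%E -> norm2 u = 1 ->
  (\int[P]_w (expR ((dotv (X w) u) ^+ 2 / (4 * K ^+ 2 + 1)))%:E <= 2%:E)%E.
Proof.
move=> mX K0 XK u1.
have mZ : measurable_fun [set: T] (fun w => dotv (X w) u).
  by apply: (measurableT_comp (measurable_dotv _ _ u)).
(* The infimum defining the psi_2 norm need not be attained at K, whence the
   slack t < 2K. *)
have : (psi2_norm P (fun w => dotv (X w) u) < (2 * K)%:E)%E.
  apply: (@le_lt_trans _ _ K%:E); last by rewrite lte_fin; lra.
  by apply: le_trans XK; apply: ereal_sup_ubound; exists u.
move=> /ereal_inf_lt[_ [t [t0 Et] <-]]; rewrite lte_fin => tK.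
apply: le_trans Et; rewrite unlock; apply: ge0_le_integral => //.
- apply/measurable_EFinP; apply: measurableT_comp => //.
  by apply: measurable_funM => //; exact: measurable_funX.
- apply/measurable_EFinP; apply: measurableT_comp => //.
  by apply: measurable_funM => //; exact: measurable_funX.
move=> w _; rewrite lee_fin ler_expR ler_wpM2l ?sqr_ge0//.
rewrite lef_pV2 ?posrE ?exprn_gt0//; first nra.
by have := sqr_ge0 K; lra.
Qed.
End row_moments.

(** * Algebra of the Euclidean norm *)

Lemma dotvZr (R : realType) (n : nat) (v u : 'cV[R]_n) (a : R) :
  dotv v (a *: u) = a * dotv v u.
Proof. by rewrite /dotv mulr_sumr; apply: eq_bigr => i _; rewrite mxE mulrCA. Qed.

Lemma norm2_eq0 (R : realType) (n : nat) (u : 'cV[R]_n) : norm2 u = 0 -> u = 0.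
Proof.
move=> u0; have /eqP := norm2_sqr _ _ u; rewrite u0 expr0n/= eq_sym.
rewrite psumr_eq0; last by move=> i _; exact: sqr_ge0.
move=> /allP h; apply/matrixP => i j; rewrite ord1 mxE.
by have := h i (mem_index_enum i); rewrite /= sqrf_eq0 => /eqP.
Qed.

Lemma norm20 (R : realType) (n : nat) : norm2 (0 : 'cV[R]_n) = 0.
Proof. by rewrite /norm2 big1 ?sqrtr0// => i _; rewrite mxE expr0n. Qed.

Lemma norm2Z (R : realType) (n : nat) (u : 'cV[R]_n) (a : R) :
  0 <= a -> norm2 (a *: u) = a * norm2 u.
Proof.
move=> a0; rewrite /norm2 (eq_bigr (fun i => a ^+ 2 * u i 0 ^+ 2)).
  by rewrite -mulr_sumr sqrtrM ?sqr_ge0// sqrtr_sqr ger0_norm.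
by move=> i _; rewrite mxE exprMn.
Qed.

(** Turns the squared length of a projected vector into an empirical mean over the rows, the form to
    which the tail bound applies. *)
Lemma norm2_scaled_mulmx_sqr (T : Type) (R : realType) (m n : nat)
    (A : T -> 'M[R]_(m, n)) (v : 'cV[R]_n) (w : T) :
  norm2 ((1 / Num.sqrt m%:R *: A w) *m v) ^+ 2 =
    m%:R^-1 * \sum_(i < m) dotv (row_vec A i w) v ^+ 2.
Proof.
rewrite norm2_sqr mulr_sumr; apply: eq_bigr => i _.
rewrite -scalemxAl mxE exprMn div1r exprVn sqr_sqrtr//; congr (_ * _ ^+ 2).
by rewrite mxE /dotv; apply: eq_bigr => j _; rewrite !mxE.
Qed.

(** * Distortion of one fixed vector *)

Section distortion.
Context d (T : measurableType d) (R : realType) (P : probability T R).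
Variables (m n : nat) (A : T -> 'M[R]_(m, n)) (K eps : R).
Hypotheses (mA : random_mx A) (indep : independent_vecs P (row_vec A)).
Hypotheses (isoA : forall i : 'I_m, isotropic P (row_vec A i))
  (psiA : forall i : 'I_m, (psi2_norm_vec P (row_vec A i) <= K%:E)%E).
Hypotheses (K0 : 0 < K) (eps01 : 0 < eps < 1) (m0 : (0 < m)%N).

(** [4 K^2] dominates [t^2] for every [t < 2K]; the summand 1 ensures [L >= 1], as [bernstein_tail]
    requires, even for small [K]. *)
Let L := 4 * K ^+ 2 + 1.
Let good v := [set w | (1 - eps) * norm2 v <=
  norm2 ((1 / Num.sqrt m%:R *: A w) *m v) <= (1 + eps) * norm2 v].

Lemma measurable_good v : measurable (good v).
Proof.
have mN : measurable_fun [set: T]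
    (fun w => norm2 ((1 / Num.sqrt m%:R *: A w) *m v)).
  have -> : (fun w => norm2 ((1 / Num.sqrt m%:R *: A w) *m v)) =
      (fun w => Num.sqrt (m%:R^-1 * \sum_(i < m) dotv (row_vec A i w) v ^+ 2)).
    apply/funext => w; rewrite -norm2_scaled_mulmx_sqr sqrtr_sqr ger0_norm//.
    exact: sqrtr_ge0.
  apply: (measurableT_comp (continuous_measurable_fun (@sqrt_continuous R))).
  apply: measurable_funM => //; apply: measurable_sum => i.
  apply: measurable_funX; apply: (measurableT_comp (measurable_dotv _ _ v)).
  exact: measurable_row_vec.
rewrite (_ : good v = (fun w => norm2 ((1 / Num.sqrt m%:R *: A w) *m v)) @^-1`
    `[(1 - eps) * norm2 v, (1 + eps) * norm2 v]%classic).
  by rewrite -[X in measurable X]setTI; apply: mN => //; exact: measurable_itv.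
by apply/seteqP; split => w /=; rewrite in_itv/=.
Qed.

Lemma distortion_prob v : (P (~` good v) <=
  (2 * expR (- (eps ^+ 2 * m%:R / (128 * L ^+ 2))))%:E)%E.
Proof.
have /andP[e0 e1] := eps01.
have m0R : 0 < m%:R :> R by rewrite ltr0n.
(* The zero vector cannot be normalised, but its bad event is empty. *)
have [v0|v0] := eqVneq (norm2 v) 0.
  rewrite (_ : ~` _ = set0) ?measure0 ?lee_fin ?mulr_ge0 ?expR_ge0//.
  apply/seteqP; split => // w; apply; rewrite /good /= v0 !mulr0.
  by rewrite (norm2_eq0 _ _ _ v0) mulmx0 norm20 lexx.
have vge0 : 0 <= norm2 v by exact: sqrtr_ge0.
have vgt0 : 0 < norm2 v by rewrite lt_neqAle eq_sym v0.
pose u := (norm2 v)^-1 *: v.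
have u1 : norm2 u = 1 by rewrite norm2Z ?invr_ge0// mulVf.
have vu : v = norm2 v *: u by rewrite scalerA mulfV// scale1r.
pose W (i : 'I_m) w := dotv (row_vec A i w) u ^+ 2.
have tail (s : R) : `|s| = 1 ->
    (P [set w | (m%:R * eps <= s * (\sum_(i < m) W i w - m%:R))%R] <=
    (expR (- (eps ^+ 2 * m%:R / (128 * L ^+ 2))))%:E)%E.
  apply: bernstein_tail => //.
  - move=> i; apply: measurable_funX; apply: (measurableT_comp (measurable_dotv _ _ u)).
    exact: measurable_row_vec.
  - by move=> i w; exact: sqr_ge0.
  - by move=> i; apply: isotropic_second_moment => //; exact: measurable_row_vec.
  - by move=> i; apply: psi2_norm_vec_exp_moment => //; exact: measurable_row_vec.
  - move=> l; apply: (expectation_prod_rows _ _ _ _ _ _ _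
      (fun v => expR (l * (dotv v u ^+ 2 - 1)))) => //.
    apply: measurableT_comp => //; apply: measurable_funM => //.
    apply: measurable_funB => //; apply: measurable_funX.
    exact: measurable_dotv.
  - by rewrite /L; have := sqr_ge0 K; lra.
have mtail (s : R) :
    measurable [set w | (m%:R * eps <= s * (\sum_(i < m) W i w - m%:R))%R].
  apply: measurable_superlevel; apply: measurable_funM => //.
  apply: measurable_funB => //; apply: measurable_sum => i.
  apply: measurable_funX; apply: (measurableT_comp (measurable_dotv _ _ u)).
  exact: measurable_row_vec.
(* Outside both tails the mean [S / m] is within [eps] of 1, and this is shown to imply [good v]. *)
apply: (@le_trans _ _ (P ([set w | (m%:R * eps <= 1 * (\sum_(i < m) W i w - m%:R))%R] `|`
    [set w | (m%:R * eps <= -1 * (\sum_(i < m) W i w - m%:R))%R]))).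
  apply: le_measure; rewrite ?inE.
  - exact/measurableC/measurable_good.
  - exact: measurableU.
  move=> w /= nE; apply: contrapT => /not_orP[/negP + /negP].
  rewrite -!ltNge mul1r mulN1r => t1 t2; apply: nE; rewrite /good/=.
  set S := \sum_(i < m) W i w in t1 t2.
  set N := norm2 (_ *m v).
  have N0 : 0 <= N by exact: sqrtr_ge0.
  have N2 : N ^+ 2 = norm2 v ^+ 2 * (S / m%:R).
    rewrite norm2_scaled_mulmx_sqr mulrA [in RHS]mulrC; congr (_ * _).
    rewrite /S mulr_sumr; apply: eq_bigr => i _.
    by rewrite {1}vu dotvZr exprMn.
  have S1 : 1 - eps <= S / m%:R by rewrite ler_pdivlMr//; lra.
  have S2 : S / m%:R <= 1 + eps by rewrite ler_pdivrMr//; lra.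
  have v20 : 0 < norm2 v ^+ 2 by rewrite exprn_gt0.
  (* Passing from squared norms to norms costs nothing in [eps]: [(1 - eps)^2 <= 1 - eps] and
     [1 + eps <= (1 + eps)^2]. *)
  apply/andP; split; rewrite -ler_sqr ?nnegrE ?mulr_ge0//; try lra.
    by rewrite N2 exprMn mulrC ler_pM2l//; nra.
  by rewrite N2 exprMn [leRHS]mulrC ler_pM2l//; nra.
apply: le_trans (measureU2 _ _ _) _ => //.
rewrite [2 * _](mulr_natl _ 2) mulr2n EFinD; apply: leeD; apply: tail.
  by rewrite normr1.
by rewrite normrN1.
Qed.
End distortion.

(** * Union bound over pairs and choice of the constant *)

Lemma probability_bigsetU_le d (T : measurableType d) (R : realType)
    (P : probability T R) (I : Type) (s : seq I) (F : I -> set T) (c : R) :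
  (forall i, measurable (F i)) -> (forall i, (P (F i) <= c%:E)%E) ->
  (P (\big[setU/set0]_(i <- s) F i) <= ((size s)%:R * c)%:E)%E.
Proof.
move=> mF Fc; elim: s => [|i s IH]; first by rewrite big_nil measure0 mul0r.
rewrite big_cons; apply: le_trans (measureU2 _ _ _) _ => //.
  exact: bigsetU_measurable.
by rewrite /= -natr1 mulrDl mul1r addrC EFinD leeD.
Qed.

Theorem theorem1p7p1 (R : realType) (K : R) (K_gt0 : 0 < K) :
  exists C : R, 0 < C /\
  forall (n N m : nat) (S : set 'cV[R]_n) (eps : R)
    (d : measure_display) (T : measurableType d) (P : probability T R)
    (A : T -> 'M[R]_(m, n)),
    (S #= `I_N)%card ->
    0 < eps < 1 ->
    random_mx A ->
    independent_vecs P (row_vec A) ->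
    (forall i : 'I_m, mean_zero P (row_vec A i)) ->
    (forall i : 'I_m, isotropic P (row_vec A i)) ->
    (forall i : 'I_m, subgaussian_vec P (row_vec A i)) ->
    (forall i : 'I_m, (psi2_norm_vec P (row_vec A i) <= K%:E)%E) ->
    C * eps ^- 2 * ln N%:R <= m%:R ->
    let Q := fun w : T => (1 / Num.sqrt m%:R) *: A w in
    let E := [set w : T | forall x y : 'cV[R]_n, S x -> S y ->
      (1 - eps) * norm2 (x - y) <= norm2 (Q w *m x - Q w *m y)
        <= (1 + eps) * norm2 (x - y)] in
    ((99 / 100)%:E <= P E)%E.
Proof.
pose L := 4 * K ^+ 2 + 1.
have L1 : 1 <= L by rewrite /L; have := sqr_ge0 K; lra.
have L20 : 0 < 128 * L ^+ 2 by rewrite mulr_gt0// exprn_gt0//; lra.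
(* The factor 10 becomes the power [N^-10]. After the union bound [2 / N^8] remains, at most
   [2 / 256 < 1 / 100] for [N >= 2]; the power 9 would leave [1 / 64] at [N = 2]. *)
exists (10 * (128 * L ^+ 2)); split; first by rewrite mulr_gt0.
move=> n N m S eps d T P A SN eps01 mA indep _ isoA _ psiA mC.
pose Q := fun w : T => (1 / Num.sqrt m%:R) *: A w.
pose E := [set w : T | forall x y : 'cV[R]_n, S x -> S y ->
  (1 - eps) * norm2 (x - y) <= norm2 (Q w *m x - Q w *m y)
    <= (1 + eps) * norm2 (x - y)].
change ((99 / 100)%:E <= P E)%E.
have /andP[e0 e1] := eps01.
have /card_set_bijP[f fbij] : (`I_N #= S)%card by rewrite card_eq_sym.
have fS x : S x -> exists i : 'I_N, f i = x.
  move=> Sx; have [i iN <-] := set_bij_surj fbij Sx.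
  by exists (Ordinal iN).
have Sf (i : 'I_N) : S (f i).
  by apply: (set_bij_sub fbij); exists (val i) => //=; exact: ltn_ord.
(* With at most one point the logarithm gives no positive lower bound on [m], but only [x = y]
   occurs and [E] is the whole space. *)
have [N1|N2] := leqP N 1.
  rewrite (_ : E = setT) ?probability_setT ?lee_fin; first lra.
  apply/seteqP; split => // w _ x y /fS[i <-] /fS[j <-].
  have -> : i = j.
    have z (k : 'I_N) : val k = 0 :> nat.
      by apply/eqP; rewrite -leqn0 -ltnS (leq_trans (ltn_ord k)).
    by apply/val_inj; rewrite !z.
  by rewrite !subrr !norm20 !mulr0 lexx.
have N0 : 0 < N%:R :> R by rewrite ltr0n (ltn_trans _ N2).
have N2R : 2 <= N%:R :> R by rewrite ler_nat.
have lnN : 0 < ln N%:R :> R by rewrite ln_gt0// ltr1n.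
have eps2 : 0 < eps ^- 2 by rewrite invr_gt0 exprn_gt0.
have m0 : (0 < m)%N.
  rewrite -(ltr0n R); apply: lt_le_trans mC.
  by rewrite mulr_gt0// mulr_gt0// mulr_gt0.
pose good v := [set w | (1 - eps) * norm2 v <= norm2 (Q w *m v) <= (1 + eps) * norm2 v].
pose F (p : 'I_N * 'I_N) := ~` good (f p.1 - f p.2).
have mF p : measurable (F p) by apply/measurableC/measurable_good.
(* All ordered pairs are taken, diagonal included, which gives exactly [N * N] events. *)
have ED : E = ~` (\big[setU/set0]_(p <- enum {: 'I_N * 'I_N}) F p).
  apply/seteqP; split => w.
    move=> wE; rewrite -bigcup_seq => -[[i j] _]; apply; rewrite /good/= mulmxBr.
    by apply: wE; apply: Sf.
  move=> wF x y /fS[i <-] /fS[j <-]; rewrite -mulmxBr.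
  apply: contrapT => nE; apply: wF; rewrite -bigcup_seq.
  by exists (i, j) => //=; rewrite mem_enum.
have mbig : measurable (\big[setU/set0]_(p <- enum {: 'I_N * 'I_N}) F p).
  exact: bigsetU_measurable.
rewrite ED probability_setC//.
pose c := 2 * expR (- (eps ^+ 2 * m%:R / (128 * L ^+ 2))).
have Fc p : (P (F p) <= c%:E)%E by exact: (distortion_prob _ _ _ _ _ _ _ K).
have := probability_bigsetU_le _ _ _ P _ (enum {: 'I_N * 'I_N}) F c mF Fc.
have -> : size (enum {: 'I_N * 'I_N}) = (N * N)%N.
  by rewrite -cardT card_prod !card_ord.
(* Writing [N^-10] as [exp(-10 ln N)] reduces this to the assumed lower bound on [m]. *)
have c_le : c <= 2 * N%:R ^- 10.
  rewrite ler_pM2l// -[in leRHS](lnK N0) -expRM_natl -expRN ler_expR lerN2.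
  rewrite ler_pdivlMr// -(ler_pM2r eps2).
  rewrite [leRHS]mulrAC mulfV ?mul1r; last by rewrite expf_neq0// gt_eqF.
  by apply: le_trans mC; rewrite le_eqVlt; apply/orP; left; apply/eqP; ring.
have cN : (N * N)%:R * c <= 1 / 100.
  have N8 : 2 ^+ 8 <= N%:R ^+ 8 :> R by rewrite lerXn2r ?nnegrE// ltW.
  apply: (@le_trans _ _ (2 / N%:R ^+ 8)).
    apply: (@le_trans _ _ ((N * N)%:R * (2 * N%:R ^- 10))); first by rewrite ler_wpM2l.
    by rewrite natrM le_eqVlt; apply/orP; left; apply/eqP; field; lra.
  by rewrite ler_pdivrMr ?exprn_gt0//; lra.
move=> PU; have {PU} : (P (\big[setU/set0]_(p <- enum {: 'I_N * 'I_N}) F p) <= (1 / 100)%:E)%E.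
  by apply: le_trans PU _; rewrite lee_fin.
rewrite (_ : (99 / 100)%:E = 1%:E - (1 / 100)%:E)%E; last first.
  by rewrite -EFinB; congr (_%:E); lra.
by move=> h; rewrite leeB.
Qed.
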